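(* Let $\mathcal H$ be a real Hilbert space, let $\Phi:\mathcal H\to\mathbb{R}\cup\{+\infty\}$ be a strongly convex, lower semicontinuous proper function, let $B:\mathcal H\to\mathcal H$ be $\beta$-cocoercive for some $\beta>0$, and let $\lambda>0$. Then the solution set $S=\{z\in\mathcal H:\ \partial\Phi(z)+Bz\ni0\}$ is reduced to a single element $\bar z$, and for any strong global solution $(x(\cdot),v(\cdot))$ of $$v(t)\in\partial\Phi(x(t)),\qquad \lambda\dot x(t)+\dot v(t)+v(t)+B(x(t))=0 ,$$ $x(t)$ converges strongly to $\bar z$ as $t\to+\infty$.
   Context: $\partial\Phi$ denotes the convex subdifferential. $B:\mathcal H\to\mathcal H$ is $\beta$-cocoercive if $\langle Bx-By,x-y\rangle\ge\beta\|Bx-By\|^2$ for all $x,y\in\mathcal H$. A strong global solution of the system is a pair $(x(\cdot),v(\cdot)):[0,+\infty[\,\to\mathcal H\times\mathcal H$ such that: $x$ and $v$ are absolutely continuous on each interval $[0,b]$, $0<b<+\infty$; $v(t)\in\partial\Phi(x(t))$ for all $t\ge 0$; $\lambda\dot x(t)+\dot v(t)+v(t)+B(x(t))=0$ for almost all $t\ge0$. *)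

(* Defs.v *)
From HB Require Import structures.
From mathcomp Require Import all_boot all_order all_algebra.
From mathcomp Require Import all_classical all_reals all_analysis.

Set Implicit Arguments.
Unset Strict Implicit.
Unset Printing Implicit Defensive.

Import Order.TTheory GRing.Theory Num.Theory.
Import numFieldNormedType.Exports.

Local Open Scope classical_set_scope.
Local Open Scope ring_scope.

(* A real Hilbert space is a complete normed space H together with an inner   *)
(* product ip (a positive definite symmetric bilinear form) inducing its norm.*)
Definition induces_norm (R : realType) (H : completeNormedModType R)
    (ip : {dot H for idfun}) :=
  forall u : H, `|u| ^+ 2 = ip u u.

Section convex_analysis.
Variables (R : realType) (H : completeNormedModType R).
Implicit Type Phi : H -> \bar R.

(* Functions with values in R U {+oo} are \bar R-valued functions avoiding -oo *)
Definition proper_function Phi :=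
  (forall x, Phi x != -oo%E) /\ (exists x, Phi x != +oo%E).

Definition strongly_convex Phi :=
  exists2 mu : R, 0 < mu & forall (x y : H) (t : R), 0 < t < 1 ->
    (Phi (t *: x + (1 - t) *: y)%R
       + (mu / 2 * t * (1 - t) * `|x - y| ^+ 2)%:E
     <= t%:E * Phi x + (1 - t)%:E * Phi y)%E.

Definition subdifferential (ip : {dot H for idfun}) Phi (x : H) : set H :=
  [set v | forall y, (Phi x + (ip v (y - x)%R)%:E <= Phi y)%E].

Definition cocoercive (ip : {dot H for idfun}) (beta : R) (B : H -> H) :=
  forall x y, beta * `|B x - B y| ^+ 2 <= ip (B x - B y) (x - y).

Definition solution_set (ip : {dot H for idfun}) Phi (B : H -> H) : set H :=
  [set z | [set v + B z | v in subdifferential ip Phi z] 0].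

End convex_analysis.

Section strong_solutions.
Variables (R : realType) (H : completeNormedModType R).

Definition absolutely_continuous_on (a b : R) (f : R -> H) :=
  forall e : R, 0 < e -> exists2 d : R, 0 < d &
    forall (n : nat) (l r : 'I_n -> R),
      (forall k, [/\ a <= l k, l k <= r k & r k <= b]) ->
      trivIset [set: 'I_n] (fun k => `]l k, r k[%classic) ->
      \sum_(k < n) (r k - l k) < d ->
      \sum_(k < n) `|f (r k) - f (l k)| < e.

(* Trajectories on [0, +oo[ are total functions on R whose values at negative *)
(* times are irrelevant: the two-sided derivative at t = 0 is the only place  *)
(* where they could matter, and {0} is negligible.                            *)
Definition strong_global_solution (ip : {dot H for idfun}) (Phi : H -> \bar R)
    (B : H -> H) (lambda : R) (x v : R -> H) :=
  [/\ forall b : R, 0 < b ->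
        absolutely_continuous_on 0 b x /\ absolutely_continuous_on 0 b v,
      forall t : R, 0 <= t -> subdifferential ip Phi (x t) (v t)
    & {ae lebesgue_measure, forall t : R, 0 <= t ->
        [/\ derivable x t 1, derivable v t 1
          & lambda *: derive1 x t + derive1 v t + v t + B (x t) = 0]}].

End strong_solutions.

(* Main.v *)
(* The zero [z] of the sum of the subdifferential and [B] is the fixed point of
   a forward-backward contraction. Along a trajectory, the energy
     E = lambda / 2 * |x - z|^2 + (Phi z - Phi x - <v, z - x>)
   is locally absolutely continuous although [Phi o x] need not be
   differentiable: the increments of [<v, x> - Phi x], the conjugate of [Phi]
   at [v], agree with [<x, dv>] up to [|dx| |dv|]. Testing the equation against
   [x - z] gives E' = - <v + B z, x - z> - <B x - B z, x - z> almost everywhere,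
   and strong convexity bounds this by [- c E] with [c > 0]. Hence E decreases
   to 0, and E dominates [lambda / 2 * |x - z|^2]. *)

Require Import Defs.
From HB Require Import structures.
From mathcomp Require Import all_boot all_order all_algebra.
From mathcomp Require Import all_classical all_reals all_analysis.
From mathcomp Require Import ring lra.

Import Order.TTheory GRing.Theory Num.Theory.
Import numFieldNormedType.Exports.

Local Open Scope classical_set_scope.
Local Open Scope ring_scope.

(** * Inner product calculus *)

Section inner_product.
Context {R : realType} {H : completeNormedModType R} (ip : {dot H for idfun}).
Hypothesis hip : induces_norm ip.

Lemma ipC u v : ip u v = ip v u.
Proof. by rewrite hermC/= expr0 mul1r. Qed.

Lemma ipDl u v w : ip (u + v) w = ip u w + ip v w.
Proof. exact: linearDl. Qed.

Lemma ipDr u v w : ip u (v + w) = ip u v + ip u w.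
Proof. exact: linearDr. Qed.

Lemma ipNl u v : ip (- u) v = - ip u v.
Proof. exact: linearNl. Qed.

Lemma ipNr u v : ip u (- v) = - ip u v.
Proof. exact: linearNr. Qed.

Lemma ipZl a u v : ip (a *: u) v = a * ip u v.
Proof. exact: linearZl_LR. Qed.

Lemma ipZr a u v : ip u (a *: v) = a * ip u v.
Proof. by rewrite ipC ipZl ipC. Qed.

Definition ipE := (ipDl, ipDr, ipNl, ipNr, ipZl, ipZr).

(** Cauchy-Schwarz: expand the squared norm of [|v| u - |u| v], then divide by [|u| |v|]. *)
Lemma ip_le_norm u v : ip u v <= `|u| * `|v|.
Proof.
have [->|v0] := eqVneq v 0.
  by rewrite normr0 mulr0 -[0](scale0r 0) ipZr mul0r.
have nv : 0 < `|v| by rewrite normr_gt0.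
have [->|u0] := eqVneq u 0.
  by rewrite normr0 mul0r -[0](scale0r 0) ipZl mul0r.
have nu : 0 < `|u| by rewrite normr_gt0.
have : 0 <= `| `|v| *: u - `|u| *: v| ^+ 2 by rewrite exprn_ge0.
rewrite hip !ipE (ipC v u) -!hip => h.
rewrite -(ler_pM2l (mulr_gt0 nu nv)); nra.
Qed.

Lemma normr_ip_le u v : `|ip u v| <= `|u| * `|v|.
Proof.
by rewrite ler_norml lerNl -ipNl -[X in _ <= X * _]normrN !ip_le_norm.
Qed.

End inner_product.

(** * Lower semicontinuity *)

Lemma lte_EFin_dense {R : realType} (c : R) (x : \bar R) : (c%:E < x)%E ->
  exists2 d, c < d & (d%:E < x)%E.
Proof.
case: x => [r|_|//]; last by exists (c + 1); rewrite ?ltry//; lra.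
rewrite lte_fin => cr; exists ((c + r) / 2); rewrite ?lte_fin; lra.
Qed.

(** A [d] strictly between [a - g x] and [f x] splits the task: near [x], [f] exceeds [d] and [g]
    exceeds [a - d]. *)
Lemma lower_semicontinuousD {R : realType} {T : topologicalType}
    (f : T -> \bar R) (g : T -> R) :
  lower_semicontinuous f -> continuous g ->
  lower_semicontinuous (fun x => (f x + (g x)%:E)%E).
Proof.
move=> lscf cg x a; rewrite -lteBlDr// -EFinB => /lte_EFin_dense[d ad dx].
have [V nV hV] := lscf _ _ dx.
exists (V `&` [set y | a - d < g y]).
  apply: filterI => //; apply: (cvgr_gt (g x)); [exact: cg | lra].
move=> y [/hV dy /= gy]; rewrite -lteBlDr// -EFinB (lt_trans _ dy)// lte_fin.
lra.
Qed.

(** * Strongly convex functions: subgradients and minimizers *)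

Section strongly_convex_subdifferential.
Context {R : realType} {H : completeNormedModType R} (ip : {dot H for idfun}).
Hypothesis hip : induces_norm ip.
Variable Phi : H -> \bar R.
Hypothesis Phi_proper : proper_function Phi.
Hypothesis Phi_lsc : lower_semicontinuous Phi.

Lemma proper_finite_point : exists x a, Phi x = a%:E.
Proof.
have [hN [x xoo]] := Phi_proper.
by exists x; move: (hN x) xoo; case: (Phi x) => // a _ _; exists a.
Qed.

Lemma proper_ltey x : (Phi x < +oo)%E -> exists a, Phi x = a%:E.
Proof.
by have := Phi_proper.1 x; case: (Phi x) => // a _ _; exists a.
Qed.

(** Tested at a point of the domain, the subgradient inequality rules out [+oo]. *)
Lemma subdifferential_finite x v :
  subdifferential ip Phi x v -> exists a, Phi x = a%:E.
Proof.
have [y [b yb]] := proper_finite_point => /(_ y); rewrite yb => h.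
apply: proper_ltey; move: h; have := Phi_proper.1 x.
by case: (Phi x) => //= r _ _; rewrite ltry.
Qed.

(** Real-valued form of strong convexity, fit for linear arithmetic; it also records that the domain
    is convex. *)
Lemma strongly_convex_fin : strongly_convex Phi ->
  exists2 mu : R, 0 < mu & forall x y a b (t : R), 0 < t < 1 ->
    Phi x = a%:E -> Phi y = b%:E ->
    exists2 c, Phi (t *: x + (1 - t) *: y) = c%:E &
      c + mu / 2 * t * (1 - t) * `|x - y| ^+ 2 <= t * a + (1 - t) * b.
Proof.
move=> [mu mu0 sc]; exists mu => // x y a b t t01 xa yb.
have := sc x y t t01.
rewrite xa yb; have := Phi_proper.1 (t *: x + (1 - t) *: y).
case: (Phi _) => // c _; rewrite -!EFinM -!EFinD lee_fin => h.
by exists c.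
Qed.

Section with_modulus.
Variable mu : R.
Hypothesis mu0 : 0 < mu.
Hypothesis Phi_sc : forall x y a b (t : R), 0 < t < 1 ->
  Phi x = a%:E -> Phi y = b%:E ->
  exists2 c, Phi (t *: x + (1 - t) *: y) = c%:E &
    c + mu / 2 * t * (1 - t) * `|x - y| ^+ 2 <= t * a + (1 - t) * b.

(** The subgradient inequality at the midpoint of [x] and [y], combined with strong convexity there,
    gives the constant [mu / 4]; the sharp [mu / 2] would take points tending to [x]. *)
Lemma subdifferential_strong x y v a b : Phi x = a%:E -> Phi y = b%:E ->
  subdifferential ip Phi x v ->
  ip v (y - x) + mu / 4 * `|x - y| ^+ 2 <= b - a.
Proof.
move=> xa yb hv.
have h01 : 0 < (2^-1 : R) < 1 by apply/andP; split; lra.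
have [c hc] := Phi_sc _ _ _ _ _ h01 xa yb.
have := hv (2^-1 *: x + (1 - 2^-1) *: y).
rewrite hc xa -EFinD lee_fin !ipE => h1 h2; nra.
Qed.

Lemma subdifferential_strong_monotone x y v w :
  subdifferential ip Phi x v -> subdifferential ip Phi y w ->
  mu / 2 * `|x - y| ^+ 2 <= ip (v - w) (x - y).
Proof.
move=> hv hw.
have [a xa] := subdifferential_finite _ _ hv.
have [b yb] := subdifferential_finite _ _ hw.
have := subdifferential_strong _ _ _ _ _ xa yb hv.
have := subdifferential_strong _ _ _ _ _ yb xa hw.
rewrite (distrC y x) !ipE; lra.
Qed.

(** Lower semicontinuity bounds [Phi] from below on a ball around [x0]. From a far [y], at distance
    [s], the segment to [x0] meets this ball, and strong convexity along it gives
    [Phi y >= a - 2 s / r + mu s^2 / 4], which is bounded below in [s]. *)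
Lemma strongly_convex_bounded_below : exists m, forall y, (m%:E <= Phi y)%E.
Proof.
have [x0 [a x0a]] := proper_finite_point.
have [V + hV] : exists2 V, nbhs x0 V & forall y, V y -> ((a - 1)%:E < Phi y)%E.
  by apply: Phi_lsc; rewrite x0a lte_fin; lra.
move=> /nbhs_ballP[r /= r0 rV].
exists (a - 1 - 4 / (mu * r ^+ 2)) => y.
have mr0 : 0 < 4 / (mu * r ^+ 2) by rewrite divr_gt0// mulr_gt0// exprn_gt0.
have [yr|ry] := ltP `|x0 - y| r.
  apply/ltW/(le_lt_trans _ (hV y (rV y _))); first by rewrite lee_fin; lra.
  by rewrite -ball_normE.
set s := `|x0 - y| in ry.
have s0 : 0 < s by apply: lt_le_trans ry.
have [->|Pyoo] := eqVneq (Phi y) +oo%E; first by rewrite leey.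
have [b yb] : exists b, Phi y = b%:E by apply: proper_ltey; rewrite ltey.
(* This weight puts the point of the segment at distance [r / 2] from [x0], inside the ball. *)
pose t := r / (2 * s).
have ts : t * s = r / 2 by rewrite /t; field; rewrite gt_eqF.
have t01 : 0 < t < 1.
  rewrite divr_gt0 ?mulr_gt0//= ltr_pdivrMr ?mulr_gt0//; lra.
have [c] := Phi_sc _ _ _ _ t t01 yb x0a.
have -> : t *: y + (1 - t) *: x0 = x0 + t *: (y - x0).
  by rewrite scalerBl scale1r scalerBr addrCA addrA.
rewrite distrC -/s => hc hcle.
have : ((a - 1)%:E < c%:E)%E.
  rewrite -hc; apply/hV/rV; rewrite -ball_normE/= opprD addrA subrr add0r.
  rewrite normrN normrZ distrC -/s gtr0_norm; last by case/andP: t01.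
  by rewrite ts; lra.
rewrite lte_fin yb lee_fin => hac.
have t12 : t <= 1 / 2 by rewrite ler_pdivrMr ?mulr_gt0//; lra.
(* Completing the square: [(mu s / 2 - 2 / r) ^ 2 / mu >= 0]. *)
have sq : 2 * s / r <= mu / 4 * s ^+ 2 + 4 / (mu * r ^+ 2).
  rewrite -subr_ge0.
  have -> : mu / 4 * s ^+ 2 + 4 / (mu * r ^+ 2) - 2 * s / r
      = (mu * s / 2 - 2 / r) ^+ 2 / mu by field; rewrite !gt_eqF.
  by rewrite divr_ge0 ?sqr_ge0// ltW.
have tsr : t * (2 * s / r) = 1.
  by rewrite /t; field; rewrite !gt_eqF.
have t0 : 0 < t by case/andP: t01.
have h1 : t * a - 1 + mu / 2 * t * (1 - t) * s ^+ 2 < t * b by lra.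
(* As [t <= 1 / 2], the factor [1 - t] can be lowered to [1 / 2], after which [t] cancels. *)
have h2 : t * (mu / 4 * s ^+ 2) <= mu / 2 * t * (1 - t) * s ^+ 2.
  have : 0 <= mu * t * (1 / 2 - t) * s ^+ 2.
    by rewrite mulr_ge0 ?sqr_ge0// mulr_ge0 ?subr_ge0// mulr_ge0// ltW.
  lra.
have : t * (a - 2 * s / r + mu / 4 * s ^+ 2) <= t * b.
  by rewrite mulrDr mulrBr tsr; lra.
rewrite ler_pM2l//; lra.
Qed.

(** Strong convexity at midpoints makes a minimizing sequence Cauchy; lower semicontinuity makes its
    limit a minimizer. *)
Lemma strongly_convex_minimizer : exists p, forall y, (Phi p <= Phi y)%E.
Proof.
have [m hm] := strongly_convex_bounded_below.
pose S := [set a | exists y, Phi y = a%:E].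
have S0 : S !=set0 by have [x [a xa]] := proper_finite_point; exists a, x.
have hS : has_inf S.
  split=> //; exists m => a [y ya].
  by have := hm y; rewrite ya lee_fin.
have Sinf a y : Phi y = a%:E -> inf S <= a.
  by move=> ya; apply: ge_inf; [exact: hS.2 | exists y].
have /choice[u hu] : forall n : nat, exists y,
    (Phi y < (inf S + n.+1%:R^-1)%:E)%E.
  move=> n; have n0 : 0 < n.+1%:R^-1 :> R by rewrite invr_gt0.
  have [a [y ya] ha] := inf_adherent n0 hS.
  by exists y; rewrite ya lte_fin.
have /choice[f hf] : forall n, exists a, Phi (u n) = a%:E.
  by move=> n; apply: proper_ltey; apply: lt_trans (hu n) _; rewrite ltry.
have hfu n : f n < inf S + n.+1%:R^-1.
  by have := hu n; rewrite hf lte_fin.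
have uu n k : mu / 8 * `|u n - u k| ^+ 2 <= (n.+1%:R^-1 + k.+1%:R^-1) / 2.
  have h01 : 0 < (2^-1 : R) < 1 by apply/andP; split; lra.
  have [c hc] := Phi_sc _ _ _ _ _ h01 (hf n) (hf k).
  have := Sinf _ _ hc; have := hfu n; have := hfu k.
  move: (n.+1%:R^-1) (k.+1%:R^-1) => i j; lra.
have cvgu : cvgn u.
  apply/cauchy_cvgP/cauchy_exP => e e0.
  have d0 : 0 < mu / 8 * e ^+ 2 by rewrite mulr_gt0 ?exprn_gt0// divr_gt0.
  have [N _ hN] := near_infty_natSinv_lt (PosNum d0).
  exists (u N); exists N => // k /= Nk; rewrite -ball_normE/=.
  rewrite -(@ltr_pXn2r _ 2) ?nnegrE ?normr_ge0 ?(ltW e0)//.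
  have := hN N (leqnn _); have := hN k Nk; have := uu N k => /= .
  move: (N.+1%:R^-1) (k.+1%:R^-1) => i j h1 h2 h3.
  by rewrite -(@ltr_pM2l _ (mu / 8)) ?divr_gt0//; lra.
pose p := limn u; exists p => y.
have hinf : ((inf S)%:E <= Phi y)%E.
  have [->|Pyoo] := eqVneq (Phi y) +oo%E; first by rewrite leey.
  have [b yb] : exists b, Phi y = b%:E by apply: proper_ltey; rewrite ltey.
  by rewrite yb lee_fin (Sinf _ _ yb).
(* Otherwise [Phi (u n)] would eventually stay above some [c > inf S]. *)
apply: (le_trans _ hinf); rewrite leNgt; apply/negP => hlt.
have [c hc1 hc2] := lte_EFin_dense _ _ hlt.
have [V nV hV] := Phi_lsc _ _ hc2.
have d0 : 0 < c - inf S by rewrite subr_gt0.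
have : \forall n \near \oo, c < f n /\ n.+1%:R^-1 < c - inf S.
  apply: filterI; last by have := near_infty_natSinv_lt (PosNum d0).
  have hn : \forall n \near \oo, V (u n) by have := cvgu V nV.
  by apply: (filterS _ hn) => n /hV; rewrite hf lte_fin.
move=> /filter_ex[n [h1 h2]]; have := hfu n.
move: (n.+1%:R^-1) h2 => i; lra.
Qed.

End with_modulus.

End strongly_convex_subdifferential.

(** * Resolvent of the subdifferential and the zero of the sum *)

Section resolvent.
Context {R : realType} {H : completeNormedModType R} (ip : {dot H for idfun}).
Hypothesis hip : induces_norm ip.
Variable Phi : H -> \bar R.
Hypothesis Phi_proper : proper_function Phi.
Hypothesis Phi_lsc : lower_semicontinuous Phi.
Hypothesis Phi_sc : strongly_convex Phi.

(** [p] is the proximal point of [w], the minimizer of [Psi = Phi + |. - w|^2 / (2 g)]; the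
    inclusion is its optimality condition. *)
Lemma resolvent_exists (g : R) (w : H) : 0 < g ->
  exists p, subdifferential ip Phi p (g^-1 *: (w - p)).
Proof.
move=> g0; have [mu mu0 sc] := strongly_convex_fin _ Phi_proper Phi_sc.
pose k := (2 * g)^-1; have k0 : 0 < k by rewrite invr_gt0 mulr_gt0.
pose Psi y := (Phi y + (k * `|y - w| ^+ 2)%:E)%E.
have Psi_proper : proper_function Psi.
  have [hN [x xoo]] := Phi_proper; split.
    by move=> y; rewrite /Psi; have := hN y; case: (Phi y).
  by exists x; rewrite /Psi; have := hN x; move: xoo; case: (Phi x).
have Psi_lsc : lower_semicontinuous Psi.
  apply: lower_semicontinuousD => // y.
  apply: cvgM; first exact: cvg_cst.
  have cn : `|z - w| @[z --> y] --> `|y - w|.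
    by apply: cvg_norm; apply: cvgB; [exact: cvg_id | exact: cvg_cst].
  exact: (cvgM cn cn).
have Psi_fin y b : Psi y = b%:E ->
    exists2 b', Phi y = b'%:E & b = b' + k * `|y - w| ^+ 2.
  by rewrite /Psi; case: (Phi y) => // b' [<-]; exists b'.
have [p hp] : exists p, forall y, (Psi p <= Psi y)%E.
  apply: (strongly_convex_minimizer Psi Psi_proper Psi_lsc mu mu0).
  move=> x y a b t t01 /Psi_fin[a' xa ->] /Psi_fin[b' yb ->].
  have [c hc hle] := sc _ _ _ _ _ t01 xa yb.
  exists (c + k * `|t *: x + (1 - t) *: y - w| ^+ 2); first by rewrite /Psi hc.
  have -> : t *: x + (1 - t) *: y - w = t *: (x - w) + (1 - t) *: (y - w).
    by rewrite !scalerBr addrACA -opprD -scalerDl subrKC scale1r.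
  (* Convexity of the squared norm comes from [t |X|^2 + (1 - t) |Y|^2 - |t X + (1 - t) Y|^2 = t (1
     - t) |X - Y|^2]; thus [Psi] keeps the modulus of [Phi]. *)
  suff : `|t *: (x - w) + (1 - t) *: (y - w)| ^+ 2 <=
      t * `|x - w| ^+ 2 + (1 - t) * `|y - w| ^+ 2.
    by move=> /(ler_wpM2l (ltW k0)); lra.
  have : 0 <= t * (1 - t) * `|(x - w) - (y - w)| ^+ 2.
    case/andP: t01 => *.
    by rewrite mulr_ge0 ?sqr_ge0// mulr_ge0// ?subr_ge0 ltW.
  rewrite !hip; move: (x - w) (y - w) => X Y; rewrite !ipE (ipC _ Y X); lra.
have [a [pa]] : exists a, Psi p = a%:E.
  have [x [b xb]] := proper_finite_point _ Psi_proper.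
  by apply: proper_ltey => //; apply: le_lt_trans (hp x) _; rewrite xb ltry.
exists p => y.
have [a' pa' _] := Psi_fin _ _ pa; rewrite pa'.
have [->|Pyoo] := eqVneq (Phi y) +oo%E; first by rewrite leey.
have [b yb] : exists b, Phi y = b%:E.
  by apply: proper_ltey => //; rewrite ltey.
rewrite yb -EFinD lee_fin.
(* Minimality against [p + t (y - p)], divided by [t], gives the inequality up to [t D]; [t] is
   chosen to make this at most [e]. *)
apply/ler_addgt0Pr => e e0.
pose D := k * `|y - p| ^+ 2.
have D0 : 0 <= D by rewrite mulr_ge0 ?sqr_ge0// ltW.
pose t := Num.min (1 / 2) (e / (D + 1)).
have t01 : 0 < t < 1.
  apply/andP; split; first by rewrite lt_min !divr_gt0// ltr_wpDl.
  by rewrite gt_min; apply/orP; left; lra.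
have tD : t * D <= e.
  have : t * (D + 1) <= e by rewrite -ler_pdivlMr ?ge_min ?lexx ?orbT//; lra.
  have : 0 < t by case/andP: t01.
  lra.
have [c hc hle] := sc _ _ _ _ _ t01 yb pa'.
have := hp (t *: y + (1 - t) *: p).
rewrite /Psi hc pa' -!EFinD lee_fin.
have -> : t *: y + (1 - t) *: p - w = t *: (y - p) + (p - w).
  by rewrite scalerBl scale1r scalerBr (addrC p) !addrA.
have /andP[t0 t1] := t01.
have : 0 <= mu / 2 * t * (1 - t) * `|y - p| ^+ 2.
  by rewrite mulr_ge0 ?sqr_ge0// mulr_ge0 ?subr_ge0 ?ltW// mulr_gt0// divr_gt0.
move: tD hle; rewrite /D -[w - p]opprB !hip; move: (y - p) (p - w) => X Y.
rewrite !ipE (ipC _ Y X) => tD hle h1 h2.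
have -> : g^-1 = 2 * k by rewrite /k; field; rewrite gt_eqF.
rewrite -(ler_pM2l t0); have := ler_wpM2l (ltW t0) tD; lra.
Qed.

Lemma solution_setE (B : H -> H) z :
  solution_set ip Phi B z <-> subdifferential ip Phi z (- B z).
Proof.
split=> [[v hv /eqP]|hz]; first by rewrite addr_eq0 => /eqP <-.
by exists (- B z) => //; rewrite addNr.
Qed.

Lemma cocoercive_monotone beta (B : H -> H) : 0 < beta ->
  cocoercive ip beta B -> forall x y, 0 <= ip (B x - B y) (x - y).
Proof.
move=> b0 hB x y; apply: le_trans (hB x y).
by rewrite mulr_ge0 ?sqr_ge0// ltW.
Qed.

(* [z] is a zero of the sum iff it is a fixed point of the forward-backward
   map [prox_(beta Phi) (z - beta B z)]; the forward step is nonexpansive by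
   cocoercivity and the backward step is a contraction by strong convexity. *)
Lemma solution_exists (beta : R) (B : H -> H) : 0 < beta ->
  cocoercive ip beta B -> exists z, solution_set ip Phi B z.
Proof.
move=> b0 hB.
have [mu mu0 sc] := strongly_convex_fin _ Phi_proper Phi_sc.
have /choice[P hP] := fun w => resolvent_exists beta w b0.
pose T x := P (x - beta *: B x).
pose q := (1 + beta * (mu / 2))^-1.
have bm0 : 0 < beta * (mu / 2) by rewrite mulr_gt0// divr_gt0.
have bm1 : 0 < 1 + beta * (mu / 2) by rewrite ltr_wpDl.
have q0 : 0 <= q by rewrite invr_ge0 ltW.
(* By cocoercivity the cross term [- 2 beta <U, V>] is at most [- 2 beta^2 |U|^2], which absorbs
   [beta^2 |U|^2]. *)
have forward x y :
    `|(x - beta *: B x) - (y - beta *: B y)| <= `|x - y|.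
  rewrite -(@ler_pXn2r _ 2) ?nnegrE//.
  have -> : x - beta *: B x - (y - beta *: B y) =
      (x - y) - beta *: (B x - B y).
    by rewrite scalerBr !opprD addrACA.
  have := hB x y; move: (B x - B y) (x - y) => U V.
  rewrite !hip !ipE (ipC _ V U) => h.
  have : 0 <= beta * (beta * ip U U).
    by rewrite -hip !mulr_ge0 ?sqr_ge0// ltW.
  have := ler_wpM2l (ltW b0) h; lra.
(* Strong monotonicity yields [(1 + beta mu / 2) |P w - P w'|^2 <= <w - w', P w - P w'>]. *)
have backward w w' : `|P w - P w'| <= q * `|w - w'|.
  rewrite /q mulrC ler_pdivlMr//.
  have [->|np] := eqVneq (`|P w - P w'|) 0; first by rewrite mul0r.
  have np0 : 0 < `|P w - P w'| by rewrite lt_def np/=.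
  have := subdifferential_strong_monotone ip _ Phi_proper _ sc _ _ _ _
    (hP w) (hP w').
  rewrite -scalerBr ipZl ler_pdivlMl//.
  have -> : w - P w - (w' - P w') = (w - w') - (P w - P w').
    by rewrite !opprD addrACA.
  have := ip_le_norm ip hip (w - w') (P w - P w').
  move: (w - w') (P w - P w') np0 => U V np0.
  by rewrite ipDl ipNl -hip => h1 h2; rewrite -(ler_pM2l np0); lra.
have ctr : is_contraction (totalfun T : {fun [set: H] >-> [set: H]}).
  exists (NngNum q0); split => /=.
    by rewrite invf_lt1// ltrDl.
  by move=> -[x y] _ /=; apply: le_trans (backward _ _) _; rewrite ler_wpM2l.
have [z _ /= zT] := banach_fixed_point ctr closedT (ex_intro _ 0 I).
have {}zT : z = T z by [].
(* At the fixed point, the subgradient [beta^-1 (z - beta B z - T z)] reduces to [- B z]. *)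
exists z; apply/solution_setE; have := hP (z - beta *: B z).
rewrite -/(T z) -zT addrAC subrr add0r scalerN scalerA mulVf ?scale1r//.
by rewrite gt_eqF.
Qed.

(** Strong monotonicity of the subdifferential, with subgradients [- B z] and [- B z'], opposes the
    monotonicity of [B] and forces [|z - z'| = 0]. *)
Lemma solution_unique (beta : R) (B : H -> H) z z' : 0 < beta ->
  cocoercive ip beta B -> solution_set ip Phi B z ->
  solution_set ip Phi B z' -> z = z'.
Proof.
move=> b0 hB /solution_setE hz /solution_setE hz'.
have [mu mu0 sc] := strongly_convex_fin _ Phi_proper Phi_sc.
have := subdifferential_strong_monotone ip _ Phi_proper _ sc _ _ _ _ hz hz'.
have := cocoercive_monotone _ _ b0 hB z z'.
rewrite -opprD ipNl !ipE => h1 h2.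
apply/eqP; rewrite -subr_eq0 -normr_eq0 -sqrf_eq0 eq_le sqr_ge0 andbT.
by rewrite -(pmulr_rle0 _ (_ : 0 < mu / 2)) ?divr_gt0//; lra.
Qed.

End resolvent.

(** * Growth of absolutely continuous functions *)

(** Cousin's lemma on fine tagged partitions, as an induction principle: [d] is the gauge at the tag
    [t]. At the supremum of the [t] with [P a t], the local property extends [P a] further unless
    [b] is reached. *)
Lemma cousin_ind {R : realType} (a b : R) (P : R -> R -> Prop) : a <= b ->
  (forall s t u, a <= s -> s <= t -> t <= u -> u <= b ->
    P s t -> P t u -> P s u) ->
  (forall t, a <= t -> t <= b -> exists2 d : R, 0 < d &
    forall s u, a <= s -> s <= t -> t <= u -> u <= b ->
      t - d < s -> u < t + d -> P s u) ->
  P a b.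
Proof.
move=> ab Ptrans Ploc.
pose S := [set t | [/\ a <= t, t <= b & P a t]].
have Sa : S a.
  have [d d0 hd] := Ploc a (lexx a) ab.
  by split=> //; apply: hd; rewrite ?lexx//; lra.
have hS : has_sup S by split; [exists a | exists b => t []].
have ac : a <= sup S by apply: ub_le_sup => //; exact: hS.2.
have cb : sup S <= b by apply: ge_sup; [exists a | move=> t []].
have [d d0 hd] := Ploc _ ac cb.
have [s [as_ sb Pas] cs] := sup_adherent d0 hS.
have sc : s <= sup S by apply: ub_le_sup => //; exact: hS.2.
pose u := Num.min b (sup S + d / 2).
have ub : u <= b by rewrite ge_min lexx.
have cu : sup S <= u by rewrite le_min cb/= lerDl; lra.
have ud : u < sup S + d by rewrite gt_min; apply/orP; right; lra.
have Pau : P a u by apply: (Ptrans a s u) => //; [lra | exact: hd].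
have uc : u <= sup S.
  by apply: ub_le_sup; [exact: hS.2 | split => //; lra].
move: Pau uc; rewrite /u; case: (leP b (sup S + d / 2)) => // h _ uc.
by exfalso; lra.
Qed.

(** Straddle lemma: splitting the increment at [t] leaves two difference quotients at [t], each
    within [e] of the derivative. *)
Lemma derivable_straddle {R : realType} (f : R -> R^o) (t e : R) : 0 < e ->
  derivable f t 1 -> exists2 d : R, 0 < d & forall s u, s <= t -> t <= u ->
    t - d < s -> u < t + d -> f u - f s <= ('D_1 f t + e) * (u - s).
Proof.
move=> e0 ft.
have /cvgrPdist_lt/(_ e e0) : (fun h => h^-1 *: (f (h *: 1 + t) - f t)) @ 0^'
  --> 'D_1 f t by exact: ft.
move=> -[d /= d0 hd]; exists d => //.
have q h : 0 < `|h| -> `|h| < d -> `|h^-1 * (f (h + t) - f t) - 'D_1 f t| < e.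
  move=> h0 hlt; have := hd h; rewrite /ball_/= sub0r normrN distrC.
  rewrite /GRing.scale/= mulr1; apply => //; by rewrite -normr_gt0.
move=> s u st tu ds ud.
have fu : f u - f t <= ('D_1 f t + e) * (u - t).
  have [->|ut] := eqVneq u t; first by rewrite !subrr mulr0.
  have ut0 : 0 < u - t by rewrite subr_gt0 lt_def ut.
  have := q (u - t); rewrite gtr0_norm// subrK => /(_ ut0 (ltac:(lra))).
  rewrite ltr_norml => /andP[_]; rewrite mulrC ltrBlDr ltr_pdivrMr//; lra.
have fs : f t - f s <= ('D_1 f t + e) * (t - s).
  have [->|ts] := eqVneq t s; first by rewrite !subrr mulr0.
  have ts0 : s - t < 0 by rewrite subr_lt0 lt_def ts.
  have := q (s - t); rewrite ltr0_norm// subrK.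
  move=> /(_ (ltac:(lra)) (ltac:(lra))).
  rewrite ltr_norml => /andP[_]; rewrite mulrC ltrBlDr ltr_ndivrMr//; lra.
lra.
Qed.

Section absolutely_continuous_growth.
Context {R : realType}.
Local Notation mu := (@lebesgue_measure R).

(** Lists ordered from left to right can be concatenated, as the gluing of partitions requires; the
    order provides the disjointness. *)
Lemma absolutely_continuous_on_seq (a b e : R) (f : R -> R^o) :
  absolutely_continuous_on a b f -> 0 < e -> exists2 d : R, 0 < d &
    forall L : seq (R * R),
      (forall p, p \in L -> [/\ a <= p.1, p.1 <= p.2 & p.2 <= b]) ->
      pairwise (fun p q => p.2 <= q.1) L ->
      \sum_(p <- L) (p.2 - p.1) < d ->
      \sum_(p <- L) `|f p.2 - f p.1| < e.
Proof.
move=> fac e0; have [d d0 hd] := fac e e0; exists d => // L hL pL.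
rewrite !(big_nth (0, 0)) !big_mkord => sL.
apply: (hd _ (fun i : 'I_(size L) => (nth (0, 0) L i).1)
             (fun i => (nth (0, 0) L i).2)) => //.
- by move=> i; apply/hL/mem_nth.
- move=> i j _ _ [x [/=]]; rewrite !in_itv/= => /andP[xi ix] /andP[xj jx].
  have key (i' j' : 'I_(size L)) : (i' < j')%N ->
      (nth (0, 0) L i').2 <= (nth (0, 0) L j').1.
    move=> ij; have /(pairwiseP (0, 0)) := pL; apply; rewrite ?inE ?ltn_ord//.
  apply: val_inj; case: (ltngtP i j) => // /key ?; exfalso; lra.
Qed.

(* A fine partition of [a, b] splits into intervals around points where the
   derivative is at most [k], and intervals inside a small open neighbourhood
   [U] of the exceptional null set, which absolute continuity takes care of. *)
Lemma absolutely_continuous_growth (a b k : R) (f : R -> R^o) : a <= b ->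
  absolutely_continuous_on a b f ->
  {ae mu, forall t, a <= t -> t <= b -> derivable f t 1 /\ 'D_1 f t <= k} ->
  f b - f a <= k * (b - a).
Proof.
move=> ab fac [A [mA A0 hA]].
apply/ler_addgt0Pr => e e0.
(* The total error is [e' (b - a)] from the points of differentiability, [e'] from absolute
   continuity and [e'] from the term in [|k|]. *)
pose c := b - a + 2; have c0 : 0 < c by rewrite /c; lra.
pose e' := e / c; have e'0 : 0 < e' by rewrite divr_gt0.
have ece : e = e' * c by rewrite /e' divfK// gt_eqF.
have [d1 d10 hd1] := absolutely_continuous_on_seq _ _ _ _ fac e'0.
(* The [1] keeps the divisor positive when [k = 0]. *)
pose K := `|k| + 1; have K0 : 0 < K by rewrite ltr_wpDl.
pose d := Num.min d1 (e' / K).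
have d0 : 0 < d by rewrite lt_min d10 divr_gt0.
have Aoo : (mu A < +oo)%E by rewrite A0.
have [U [oU AU mUA]] : exists U : set R,
    [/\ open U, A `<=` U & (mu (U `\` A) < d%:E)%E].
  exact: lebesgue_regularity_outer mA Aoo d0.
have mU : measurable U by exact: measurable_realfun.open_measurable.
have muU : (mu U < d%:E)%E.
  rewrite -[X in mu X](setDUK AU).
  have : (mu (A `|` (U `\` A)) <= mu A + mu (U `\` A))%E.
    exact: measureU2 mA (measurableD mU mA).
  by rewrite A0 add0e => /le_lt_trans; apply.
(* [L] collects the intervals tagged by points of [A], which lie in [U]. The intervals []s, u]] are
   half-open so that the measures add up exactly when two pieces are joined. *)
pose P s u := exists L : seq (R * R),
  [/\ forall p, p \in L -> [/\ s <= p.1, p.1 <= p.2 & p.2 <= u],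
      pairwise (fun p q => p.2 <= q.1) L,
      (\sum_(p <- L) (p.2 - p.1)%:E <= mu (U `&` `]s, u]))%E &
      f u - f s - k * (u - s) <= e' * (u - s) +
        \sum_(p <- L) (`|f p.2 - f p.1| + `|k| * (p.2 - p.1))].
have [L [hL pL mL fL]] : P a b.
  apply: cousin_ind => // [s t u as_ st tu ub|t at_ tb].
    move=> [L1 [h1 p1 m1 f1]] [L2 [h2 p2 m2 f2]].
    exists (L1 ++ L2); split.
    - move=> p; rewrite mem_cat => /orP[/h1|/h2] [? ? ?]; split => //; lra.
    - rewrite pairwise_cat p1 p2 !andbT.
      by apply/allrelP => p q /h1[_ _ ?] /h2[? _ _]; lra.
    - rewrite big_cat/=.
      have -> : U `&` `]s, u] = (U `&` `]s, t]) `|` (U `&` `]t, u]).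
        rewrite -setIUr; congr (_ `&` _); apply/seteqP; split => x /=;
          rewrite !in_itv/=.
          by move=> /andP[sx xu]; case: (leP x t) => xt; [left|right]; lra.
        by move=> [] /andP[? ?]; apply/andP; split; lra.
      rewrite measureU; [exact: leeD| | |].
      + by apply: measurableI => //; exact: measurable_itv.
      + by apply: measurableI => //; exact: measurable_itv.
      + rewrite -subset0 => x [[_ /=]]; rewrite in_itv/= => /andP[_ h] [_ /=].
        by rewrite in_itv/= => /andP[h' _]; lra.
    - rewrite big_cat/=; lra.
  have [At|nAt] := pselect (A t).
    have /nbhs_ballP[r /= r0 hr] : nbhs t U.
      by apply: open_nbhs_nbhs; split => //; exact: AU.
    exists r => // s u as_ st tu ub rs ru; exists [:: (s, u)]; split => //=.
    - by move=> p; rewrite inE => /eqP -> /=; split => //; lra.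
    - rewrite big_seq1/= (_ : _ `&` _ = `]s, u]%classic).
        by rewrite lebesgue_measure_itv/= lte_fin; case: ltP => // h;
          rewrite ?EFinB// lee_fin; lra.
      rewrite setIidr// => x /=; rewrite in_itv/= => /andP[sx xu].
      by apply: hr; rewrite -ball_normE/= ltr_norml; lra.
    - rewrite big_seq1/=.
      have := ler_norm (f u - f s); have := ler_norm (- k); rewrite normrN.
      move=> /(ler_wpM2r (_ : 0 <= u - s)) => h; have := h (ltac:(lra)).
      have : 0 <= e' * (u - s) by rewrite mulr_ge0 ?(ltW e'0)//; lra.
      lra.
  have [ft fk] : derivable f t 1 /\ 'D_1 f t <= k.
    by apply: contrapT => h; apply/nAt/hA => /(_ at_ tb).
  have [r r0 hr] := derivable_straddle _ _ _ e'0 ft.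
  exists r => // s u as_ st tu ub rs ru; exists [::]; split => //=.
    by rewrite big_nil measure_ge0.
  rewrite big_nil addr0; have := hr s u st tu rs ru.
  have : 0 <= (k - 'D_1 f t) * (u - s) by rewrite mulr_ge0//; lra.
  lra.
have sL : \sum_(p <- L) (p.2 - p.1) < d.
  rewrite -lte_fin -sumEFin; apply: le_lt_trans muU; apply: le_trans mL _.
  apply: le_measure; rewrite ?inE//.
  by apply: measurableI => //; exact: measurable_itv.
have := hd1 L hL pL _.
have s1 : \sum_(p <- L) (p.2 - p.1) < d1.
  by apply: lt_le_trans sL _; rewrite ge_min lexx.
have s2 : `|k| * (\sum_(p <- L) (p.2 - p.1)) <= e'.
  have : K * d <= e' by rewrite mulrC -ler_pdivlMr// ge_min lexx orbT.
  have : 0 <= \sum_(p <- L) (p.2 - p.1).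
    by rewrite big_seq; apply: sumr_ge0 => p /hL[_ ? _]; rewrite subr_ge0.
  have := ler_wpM2l (normr_ge0 k) (ltW sL); rewrite /K; nra.
move=> /(_ s1); move: fL; rewrite big_split/= -mulr_sumr ece /c; lra.
Qed.

End absolutely_continuous_growth.

(** * Absolute continuity: boundedness and domination *)

Section absolute_continuity_tools.
Context {R : realType} {H : completeNormedModType R}.

Lemma absolutely_continuous_onS (a b a' b' : R) (f : R -> H) :
  a <= a' -> b' <= b ->
  absolutely_continuous_on a b f -> absolutely_continuous_on a' b' f.
Proof.
move=> aa bb fac e e0; have [d d0 hd] := fac e e0; exists d => // n l r lr.
by apply: hd => k; have [? ? ?] := lr k; split; lra.
Qed.

(** Increments over intervals shorter than [d] stay below 1, so boundedness holds locally; the sum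
    of the bounds on two adjacent intervals bounds [f] on their union. *)
Lemma absolutely_continuous_on_bounded (a b : R) (f : R -> H) : a <= b ->
  absolutely_continuous_on a b f ->
  exists2 M, 0 <= M & forall t, a <= t -> t <= b -> `|f t| <= M.
Proof.
move=> ab fac; have [d d0 hd] := fac 1 ltr01.
have unif s t : a <= s -> s <= t -> t <= b -> t - s < d ->
    `|f t - f s| < 1.
  move=> as_ st tb ts.
  have := hd 1%N (fun=> s) (fun=> t); rewrite !big_ord1; apply => //.
  by move=> i j _ _ _; rewrite (ord1 i) (ord1 j).
pose P s u :=
  exists2 M : R, 0 <= M & forall t, s <= t -> t <= u -> `|f t| <= M.
apply: (@cousin_ind _ a b P) => // [s t u _ _ _ _|t at_ tb].
  move=> [M1 M10 h1] [M2 M20 h2]; exists (M1 + M2); first exact: addr_ge0.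
  move=> r sr ru; have [rt|/ltW tr] := leP r t.
    by have := h1 r sr rt; lra.
  by have := h2 r tr ru; lra.
exists d => // s u as_ st tu ub ds ud; exists (`|f t| + 1).
  by rewrite addr_ge0.
move=> r sr ru; have : `|f r - f t| < 1.
  have [rt|/ltW tr] := leP r t; first by rewrite distrC; apply: unif; lra.
  by apply: unif; lra.
have := ler_normD (f r - f t) (f t); rewrite subrK; lra.
Qed.

(** Serves to carry absolute continuity from [x] and [v] over to the energy, whose increments are
    dominated by theirs. *)
Lemma absolutely_continuous_on_dominated (a b C : R) (g : R -> R^o)
    (x v : R -> H) : 0 <= C ->
  absolutely_continuous_on a b x -> absolutely_continuous_on a b v ->
  (forall s t, a <= s -> s <= t -> t <= b ->
     `|g t - g s| <= C * (`|x t - x s| + `|v t - v s|)) ->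
  absolutely_continuous_on a b g.
Proof.
move=> C0 xac vac hg e e0.
(* Using [C + 1] avoids a division by zero when [C = 0]. *)
have C1 : 0 < C + 1 by rewrite ltr_wpDl.
have e20 : 0 < e / (C + 1) / 2 by rewrite !divr_gt0.
have [d1 d10 hd1] := xac _ e20; have [d2 d20 hd2] := vac _ e20.
exists (Num.min d1 d2); first by rewrite lt_min d10 d20.
move=> n l r lr tlr; rewrite lt_min => /andP[s1 s2].
have := hd1 n l r lr tlr s1; have := hd2 n l r lr tlr s2.
set Sv := \sum_(k < n) `|v _ - _|; set Sx := \sum_(k < n) `|x _ - _| => hv hx.
have Sx0 : 0 <= Sx by exact: sumr_ge0.
have Sv0 : 0 <= Sv by exact: sumr_ge0.
have : \sum_(k < n) `|g (r k) - g (l k)| <= C * (Sx + Sv).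
  rewrite -big_split/= mulr_sumr; apply: ler_sum => k _.
  by have [? ? ?] := lr k; apply: hg.
move/le_lt_trans; apply.
have h : (C + 1) * (Sx + Sv) < e.
  rewrite mulrC -ltr_pdivlMr//; move: hv hx; lra.
move: h; lra.
Qed.

End absolute_continuity_tools.

(** * Energy decay along a trajectory *)

Section trajectory.
Context {R : realType} {H : completeNormedModType R} (ip : {dot H for idfun}).
Hypothesis hip : induces_norm ip.
Variable Phi : H -> \bar R.
Hypothesis Phi_proper : proper_function Phi.
Hypothesis Phi_sc : strongly_convex Phi.
Variables (B : H -> H) (lambda : R).
Hypothesis lambda0 : 0 < lambda.
Hypothesis B_mono : forall x y, 0 <= ip (B x - B y) (x - y).
Variable z : H.
Hypothesis z_sol : subdifferential ip Phi z (- B z).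
Variables x v : R -> H.
Hypothesis xv : forall t, 0 <= t -> subdifferential ip Phi (x t) (v t).

(* The second summand is the Bregman distance from [x t] to [z]. *)
Definition lyapunov (t : R) : R^o := lambda / 2 * `|x t - z| ^+ 2 +
  (fine (Phi z) - fine (Phi (x t)) - ip (v t) (z - x t)).

Let phi t := fine (Phi (x t)).

Let Phi_x t : 0 <= t -> Phi (x t) = (phi t)%:E.
Proof.
by move=> /xv/(subdifferential_finite _ _ Phi_proper)[a xa]; rewrite /phi xa.
Qed.

Let Phi_z : Phi z = (fine (Phi z))%:E.
Proof.
by have [a za] := subdifferential_finite _ _ Phi_proper _ _ z_sol; rewrite za.
Qed.

Lemma lyapunov_ge t : 0 <= t ->
  lambda / 2 * `|x t - z| ^+ 2 <= lyapunov t.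
Proof.
move=> t0; have := xv _ t0 z; rewrite Phi_z Phi_x// -EFinD lee_fin.
by rewrite /lyapunov -/(phi t); lra.
Qed.

(** The quadratic term leaves the remainder [lambda / 2 |x s - x t|^2]. The Bregman term leaves
    [phi t - phi s + <v s, x s - x t>], which the subgradient inequalities at [x s] and [x t] place
    between 0 and [<v s - v t, x s - x t>]. *)
Lemma lyapunov_increment s t : 0 <= s -> 0 <= t ->
  `|lyapunov s - lyapunov t -
    ip (lambda *: (x s - x t) + (v s - v t)) (x t - z)| <=
  `|x s - x t| * (lambda / 2 * `|x s - x t| + `|v s - v t|).
Proof.
move=> s0 t0.
have := xv _ s0 (x t); have := xv _ t0 (x s).
rewrite !Phi_x// -!EFinD !lee_fin => h1 h2.
have := ip_le_norm ip hip (v s - v t) (x s - x t).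
have -> : lyapunov s - lyapunov t -
    ip (lambda *: (x s - x t) + (v s - v t)) (x t - z) =
    lambda / 2 * `|x s - x t| ^+ 2 + (phi t - phi s + ip (v s) (x s - x t)).
  rewrite /lyapunov -/(phi s) -/(phi t) !hip !ipE.
  by rewrite (ipC _ (x t) (x s)) (ipC _ z (x s)) (ipC _ z (x t)); field.
move: h1 h2; rewrite !ipE => h1 h2 h3.
have : 0 <= lambda / 2 * `|x s - x t| ^+ 2.
  by rewrite mulr_ge0 ?sqr_ge0// divr_ge0// ltW.
by move=> h4; rewrite ger0_norm; lra.
Qed.

(** On a compact interval [|x - z|] is bounded, so [lyapunov_increment] bounds the increments of the
    energy linearly by those of [x] and [v]. *)
Lemma lyapunov_absolutely_continuous a b : 0 <= a -> a <= b ->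
  absolutely_continuous_on a b x -> absolutely_continuous_on a b v ->
  absolutely_continuous_on a b lyapunov.
Proof.
move=> a0 ab xac vac.
have [M M0 hM] := absolutely_continuous_on_bounded _ _ _ ab xac.
pose N := M + `|z|; have N0 : 0 <= N by rewrite addr_ge0.
have hN t : a <= t -> t <= b -> `|x t - z| <= N.
  by move=> at_ tb; rewrite (le_trans (ler_normB _ _))// lerD2r hM.
(* In [2 lambda + 3], the inner product accounts for [lambda] and 1; the remainder, using
   [|x t - x s| <= 2 N], for another [lambda] and 2. *)
apply: (absolutely_continuous_on_dominated _ _ ((2 * lambda + 3) * N)
  _ x v) => //.
  by rewrite mulr_ge0// addr_ge0// mulr_ge0// ltW.
move=> s t as_ st tb.
have hs : 0 <= s by lra.
have ht : 0 <= t by lra.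
have := lyapunov_increment _ _ ht hs.
have := normr_ip_le ip hip (lambda *: (x t - x s) + (v t - v s)) (x s - z).
have := ler_normD (lambda *: (x t - x s)) (v t - v s).
rewrite normrZ gtr0_norm//.
have := hN s as_ (le_trans st tb); have := hN t (le_trans as_ st) tb.
have : `|x t - x s| <= `|x t - z| + `|x s - z| 
  by rewrite [X in _ <= _ + X]distrC ler_distD.
have := ler_normD (lyapunov t - lyapunov s -
  ip (lambda *: (x t - x s) + (v t - v s)) (x s - z))
  (ip (lambda *: (x t - x s) + (v t - v s)) (x s - z)).
rewrite subrK.
move: (ip _ _) (lyapunov t - _) => I L.
move: `|_ *: _ + _| (normr_ge0 (lambda *: (x t - x s) + (v t - v s))) => A A0.
move: `|x t - x s| (normr_ge0 (x t - x s)) => X X0.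
move: `|v t - v s| (normr_ge0 (v t - v s)) => V V0.
move: `|x t - z| `|x s - z| (normr_ge0 (x s - z)) => Zt Zs Zs0.
move=> h1 h2 h3 h4 h5 h6 h7.
have k1 : A * Zs <= (lambda * X + V) * N.
  by apply: ler_pM.
have k2 : X * (lambda / 2 * X + V) <= 2 * N * (lambda / 2 * X + V).
  by apply: ler_wpM2r; [rewrite addr_ge0// mulr_ge0// divr_ge0// ltW | lra].
have := mulr_ge0 N0 X0; have := mulr_ge0 N0 V0.
have := mulr_ge0 (ltW lambda0) (mulr_ge0 N0 V0).
lra.
Qed.

(** The remainder in [lyapunov_increment] is quadratic in the increments, so after division by [h]
    only the linear part survives. *)
Lemma lyapunov_derive t : 0 < t -> derivable x t 1 -> derivable v t 1 ->
  is_derive t 1 lyapunov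
    (ip (lambda *: derive1 x t + derive1 v t) (x t - z)).
Proof.
move=> t0 dx dv.
set L := _ + _; set K := ip _ _.
pose X h := h^-1 *: (x (h *: 1 + t) - x t).
pose V h := h^-1 *: (v (h *: 1 + t) - v t).
have cX : X h @[h --> 0^'] --> derive1 x t by rewrite derive1E; exact: dx.
have cV : V h @[h --> 0^'] --> derive1 v t by rewrite derive1E; exact: dv.
have c0 : h @[h --> (0 : R)^'] --> (0 : R) by exact: cvg_within.
(* The first term compares the difference quotients of [x] and [v] with their derivatives; the
   second is the quadratic remainder divided by [|h|]. *)
pose b h := `|lambda *: X h + V h - L| * `|x t - z| +
  `|h| * (`|X h| * (lambda / 2 * `|X h| + `|V h|)).
have cb : b h @[h --> 0^'] --> 0.
  have c1 : lambda *: X h + V h - L @[h --> 0^'] --> L - L.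
    apply: cvgB; last exact: cvg_cst.
    by apply: cvgD => //; apply: cvgZr.
  have := cvgD (cvgM (cvg_norm c1) (cvg_cst `|x t - z|))
    (cvgM (cvg_norm c0) (cvgM (cvg_norm cX)
      (cvgD (cvgM (cvg_cst (lambda / 2)) (cvg_norm cX)) (cvg_norm cV)))).
  by rewrite subrr !normr0 !mul0r add0r; apply.
pose q (h : R) : R := h^-1 * (lyapunov (h *: 1 + t) - lyapunov t).
have qb : \forall h \near 0^', 0 <= `|q h - K| <= b h.
  near=> h; rewrite normr_ge0/=.
  have h0 : h != 0 by near: h; exact: nbhs_dnbhs_neq.
  have hn0 : 0 < `|h| by rewrite normr_gt0.
  (* Subgradients are available at nonnegative times only; [0 < t] leaves room for negative [h]. *)
  have ht : 0 <= h *: 1 + t.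
    have : `|h| < t by near: h; exact: dnbhs0_lt.
    by rewrite /GRing.scale/= mulr1 ltr_norml => /andP[? ?]; lra.
  have := lyapunov_increment _ _ ht (ltW t0).
  have -> : x (h *: 1 + t) - x t = h *: X h.
    by rewrite scalerA divff// scale1r.
  have -> : v (h *: 1 + t) - v t = h *: V h.
    by rewrite scalerA divff// scale1r.
  have -> : lyapunov (h *: 1 + t) - lyapunov t = h * q h.
    by rewrite /q mulrA divff// mul1r.
  rewrite scalerA (mulrC lambda) -scalerA -scalerDr ipZl -mulrBr.
  rewrite !(normrZ h) => hE.
  have := ler_normD (q h - ip (lambda *: X h + V h) (x t - z))
    (ip (lambda *: X h + V h - L) (x t - z)).
  have -> : q h - ip (lambda *: X h + V h) (x t - z) +
    ip (lambda *: X h + V h - L) (x t - z) = q h - K.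
    by rewrite (ipDl _ _ (- L)) ipNl addrA subrK.
  move=> /le_trans; apply; rewrite /b addrC lerD ?normr_ip_le//.
  by rewrite -(ler_pM2l hn0) (le_trans hE)//; lra.
have cq : `|q h - K| @[h --> 0^'] --> 0.
  by apply: (squeeze_cvgr qb); [exact: cvg_cst | exact: cb].
have {}cq : (fun h => h^-1 *: (lyapunov (h *: 1 + t) - lyapunov t)) @ 0^' --> K.
  exact: (subr_cvg0 q K).1 (norm_cvg0 cq).
have dE : derivable lyapunov t 1 by apply/cvg_ex; exists K.
by apply: DeriveDef => //; apply: cvg_lim cq.
Unshelve. all: by end_near. Qed.

(** With [D] the Bregman term, [<v + B z, x - z> = D + (Phi x - Phi z + <B z, x - z>)], and strong
    convexity at [z] bounds the bracket below by [mu / 4 |x - z|^2]. The rate [c] is chosen so that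
    [c <= 1] and [c lambda / 2 <= mu / 4]. *)
Lemma lyapunov_derivative_le t mu : 0 <= t -> 0 < mu ->
  (forall x y a b (t : R), 0 < t < 1 -> Phi x = a%:E -> Phi y = b%:E ->
    exists2 c, Phi (t *: x + (1 - t) *: y) = c%:E &
      c + mu / 2 * t * (1 - t) * `|x - y| ^+ 2 <= t * a + (1 - t) * b) ->
  ip (- (v t + B (x t))) (x t - z) <=
    - Num.min 1 (mu / (2 * lambda)) * lyapunov t.
Proof.
move=> t0 mu0 sc.
have := subdifferential_strong ip Phi mu sc _ _ _ _ _ Phi_z (Phi_x t t0) z_sol.
have := B_mono (x t) z; rewrite distrC.
have := xv _ t0 z; rewrite Phi_z Phi_x// -EFinD lee_fin.
have -> : - (v t + B (x t)) = - (v t - - B z) - (B (x t) - B z).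
  by rewrite opprK -opprD addrACA subrr addr0.
rewrite ipDl ipNl /lyapunov -/(phi t).
set c := Num.min _ _; move=> h1 h2 h3.
have c1 : c <= 1 by rewrite ge_min lexx.
have c2 : c * (lambda / 2) <= mu / 4.
  rewrite -ler_pdivlMr ?divr_gt0// ge_min; apply/orP; right.
  rewrite le_eqVlt; apply/orP; left; apply/eqP.
  by field; rewrite gt_eqF.
have n0 : 0 <= `|x t - z| ^+ 2 by rewrite sqr_ge0.
have := ler_wpM2r n0 c2.
have : c * (fine (Phi z) - phi t - ip (v t) (z - x t)) <=
    fine (Phi z) - phi t - ip (v t) (z - x t).
  by rewrite ler_piMl//; lra.
move: h1 h2 h3; rewrite !ipE; lra.
Qed.

Hypothesis xv_ac : forall b, 0 < b ->
  absolutely_continuous_on 0 b x /\ absolutely_continuous_on 0 b v.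
Hypothesis xv_eq : {ae lebesgue_measure, forall t : R, 0 <= t ->
  [/\ derivable x t 1, derivable v t 1
    & lambda *: derive1 x t + derive1 v t + v t + B (x t) = 0]}.

(** Integrated decay, used twice: [e = 0] gives monotonicity, and [e > 0] shows that the energy
    cannot stay above [e]. *)
Lemma lyapunov_decay : exists2 c, 0 < c & forall e a b, 0 <= e ->
  0 < a -> a <= b -> (forall t, a <= t -> t <= b -> e <= lyapunov t) ->
  lyapunov b - lyapunov a <= - (c * e) * (b - a).
Proof.
have [mu mu0 sc] := strongly_convex_fin _ Phi_proper Phi_sc.
pose c := Num.min 1 (mu / (2 * lambda)).
have c0 : 0 < c by rewrite lt_min ltr01 divr_gt0// mulr_gt0.
exists c => // e a b e0 a0 ab he.
have [xac vac] := xv_ac _ (lt_le_trans a0 ab).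
apply: absolutely_continuous_growth => //.
  apply: lyapunov_absolutely_continuous => //; first exact: ltW.
    exact: absolutely_continuous_onS (ltW a0) (lexx b) xac.
  exact: absolutely_continuous_onS (ltW a0) (lexx b) vac.
have [A [mA A0 hA]] := xv_eq; exists A; split => // t nt.
apply/hA => ht; apply: nt => at_ tb.
have t0 : 0 < t by exact: lt_le_trans at_.
have [dx dv xve] := ht (ltW t0).
have dE := lyapunov_derive _ t0 dx dv.
split; first exact: ex_derive.
rewrite derive_val.
have -> : lambda *: derive1 x t + derive1 v t = - (v t + B (x t)).
  by apply/eqP; rewrite -addr_eq0 addrA xve.
apply: le_trans (lyapunov_derivative_le _ _ (ltW t0) mu0 sc) _.
by rewrite mulNr lerN2 -/c ler_pM2l// he.
Qed.

Lemma trajectory_cvg : x t @[t --> +oo] --> z.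
Proof.
have [c c0 hc] := lyapunov_decay.
have E0 t : 0 < t -> 0 <= lyapunov t.
  move=> /ltW t0; apply: le_trans (lyapunov_ge _ t0).
  by rewrite mulr_ge0 ?sqr_ge0// divr_ge0// ltW.
have decr s t : 0 < s -> s <= t -> lyapunov t <= lyapunov s.
  move=> s0 st; have := hc 0 s t (lexx _) s0 st.
  rewrite mulr0 oppr0 mul0r subr_le0; apply=> r sr _.
  by apply: E0; exact: lt_le_trans sr.
apply/cvgrPdist_lt => e e0.
pose d := lambda / 2 * e ^+ 2.
have d0 : 0 < d by rewrite mulr_gt0 ?exprn_gt0// divr_gt0.
have cd0 : 0 < c * d by exact: mulr_gt0.
(* If the energy stayed above [d] from time 1 on, it would lose [lyapunov 1 + 1] by the time
   [1 + (lyapunov 1 + 1) / (c d)] and become negative. *)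
have [T T1 ET] : exists2 T, 1 <= T & lyapunov T < d.
  apply: contrapT => nT.
  have hd t : 1 <= t -> d <= lyapunov t.
    by move=> t1; rewrite leNgt; apply/negP => h; apply: nT; exists t.
  pose T := 1 + (lyapunov 1 + 1) / (c * d).
  have T1 : 1 <= T.
    by rewrite lerDl divr_ge0 ?(ltW cd0)// addr_ge0// E0.
  have := hc d 1 T (ltW d0) ltr01 T1 (fun t h _ => hd t h).
  have -> : - (c * d) * (T - 1) = - (lyapunov 1 + 1).
    by rewrite /T addrAC subrr add0r mulNr mulrC divfK// gt_eqF.
  have := E0 T (lt_le_trans ltr01 T1); lra.
near=> t.
have Tt : T <= t by near: t; apply: nbhs_pinfty_ge; exact: num_real.
have T0 : 0 < T by exact: lt_le_trans T1.
have t0 : 0 <= t by exact: le_trans (ltW T0) Tt.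
rewrite distrC -(@ltr_pXn2r _ 2) ?nnegrE ?normr_ge0 ?(ltW e0)//.
have l20 : 0 < lambda / 2 by rewrite divr_gt0.
rewrite -(ltr_pM2l l20) -/d.
apply: le_lt_trans ET.
exact: le_trans (lyapunov_ge _ t0) (decr _ _ T0 Tt).
Unshelve. all: by end_near. Qed.

End trajectory.

Theorem corollary1p17 (R : realType) (H : completeNormedModType R)
    (ip : {dot H for idfun}) (hip : induces_norm ip)
    (Phi : H -> \bar R) (Phi_proper : proper_function Phi)
    (Phi_lsc : lower_semicontinuous Phi) (Phi_sc : strongly_convex Phi)
    (B : H -> H) (beta : R) (beta_gt0 : 0 < beta)
    (B_coco : cocoercive ip beta B)
    (lambda : R) (lambda_gt0 : 0 < lambda) :
  exists zbar : H,
    solution_set ip Phi B = [set zbar] /\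
    forall x v : R -> H, strong_global_solution ip Phi B lambda x v ->
      x t @[t --> +oo] --> zbar.
Proof.
have [z hz] := solution_exists ip hip Phi Phi_proper Phi_lsc Phi_sc _ _
  beta_gt0 B_coco.
exists z; split.
  apply/seteqP; split=> [z' hz'|_ ->//].
  exact: (solution_unique ip Phi Phi_proper Phi_sc _ _ _ _ beta_gt0 B_coco).
move=> x v [xvac xv xveq].
apply: (trajectory_cvg ip hip Phi Phi_proper Phi_sc B lambda lambda_gt0
  (cocoercive_monotone ip _ _ beta_gt0 B_coco) z _ x v) => //.
exact/solution_setE.
Qed.
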